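(* Let $\widehat{H}$ be a finite weakly balanced bipartite signed graph with no purely red edges, and let $\le$ be a special min ordering of $\widehat H$. Let $\widehat G$ be a signed graph, let $C$ be a closed walk in $\widehat{G}$, and let $f, f'$ be two homomorphisms of $\widehat{G}$ to $\widehat{H}$ such that for every vertex $v$ of $\widehat{G}$, $f(v)$ and $f'(v)$ lie in the same part of $H$ and $f(v) \leq f'(v)$, and such that the image $f(C)$ contains only blue edges while the image $f'(C)$ contains a bicoloured edge. Then the homomorphic images $f(C)$ and $f'(C)$ are disjoint (have no common vertex).
   Context: A signed graph is a graph whose edges each carry the sign $+$ (blue), $-$ (red), or both (bicoloured); an edge with exactly one sign is unicoloured. $\widehat H$ is weakly balanced with no purely red edges, so its unicoloured edges are blue; it is bipartite with underlying graph $H$ having parts $A,B$. A homomorphism of a signed graph $\widehat G$ to $\widehat H$ is a homomorphism $f$ of the underlying graphs mapping bicoloured edges to bicoloured edges such that every closed walk $W$ of unicoloured edges of $\widehat G$ whose image $f(W)$ consists of unicoloured edges has the same parity of the number of red edges as $f(W)$. A min ordering of $H$ is a pair of linear orders of $A$ and of $B$ such that whenever $ab, a'b'$ are edges with $a,a'\in A$, $a<a'$, $b,b'\in B$, $b'<b$, then $ab'$ is an edge. A special min ordering of $\widehat H$ is a min ordering of $H$ such that at each vertex, every neighbour joined to it by a bicoloured edge precedes every neighbour joined to it by a unicoloured edge. *)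

(* Defs.v *)
From mathcomp Require Import all_boot.

Set Implicit Arguments.
Unset Strict Implicit.
Unset Printing Implicit Defensive.

(* An edge is bicoloured when it carries both signs; parallel edges of opposite
   signs are thus one bicoloured edge of the underlying simple graph. *)
Record sgraph (V : Type) := SGraph {
  plus : rel V;
  minus : rel V;
  plus_sym : symmetric plus;
  minus_sym : symmetric minus
}.

Section SignedGraph.

Variables (V : Type) (G : sgraph V).

Definition adj : rel V := fun u v => plus G u v || minus G u v.
Definition bicoloured : rel V := fun u v => plus G u v && minus G u v.
Definition blue : rel V := fun u v => plus G u v && ~~ minus G u v.
Definition red : rel V := fun u v => minus G u v && ~~ plus G u v.
Definition unicoloured : rel V := fun u v => blue u v || red u v.

(* The pair (x, p) stands for the walk visiting the vertices of x :: p. *)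
Definition closed_walk (x : V) (p : seq V) : Prop :=
  path adj x p /\ last x p = x.

Definition walk_edges (x : V) (p : seq V) : seq (V * V) := zip (belast x p) p.

Definition only_edges (c : rel V) (x : V) (p : seq V) : bool :=
  all (fun e => c e.1 e.2) (walk_edges x p).

Definition some_edge (c : rel V) (x : V) (p : seq V) : bool :=
  has (fun e => c e.1 e.2) (walk_edges x p).

Definition red_count (x : V) (p : seq V) : nat :=
  count (fun e => red e.1 e.2) (walk_edges x p).

Definition weakly_balanced : Prop :=
  forall (x : V) (p : seq V),
    closed_walk x p -> only_edges unicoloured x p -> ~~ odd (red_count x p).

Definition no_purely_red : Prop := forall u v : V, ~~ red u v.

End SignedGraph.

Definition is_shom (V W : Type) (G : sgraph V) (H : sgraph W) (f : V -> W) : Prop :=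
  [/\ forall u v, adj G u v -> adj H (f u) (f v),
      forall u v, bicoloured G u v -> bicoloured H (f u) (f v)
    & forall x p,
        closed_walk G x p ->
        only_edges (unicoloured G) x p ->
        only_edges (unicoloured H) (f x) (map f p) ->
        odd (red_count G x p) = odd (red_count H (f x) (map f p))].

Section MinOrdering.

Variables (W : finType) (H : sgraph W) (A B : {set W}) (leA leB : rel W).

Definition bipartition : Prop :=
  [/\ A :|: B = [set: W], A :&: B = set0
    & forall u v, adj H u v ->
        (u \in A) && (v \in B) || (u \in B) && (v \in A)].

(* Only the restriction of the relation to D matters. *)
Definition linear_order_on (D : {set W}) (le : rel W) : Prop :=
  [/\ {in D, reflexive le}, {in D &, antisymmetric le},
      {in D & &, transitive le} & {in D &, total le}].

Definition strict (le : rel W) : rel W := fun x y => le x y && (x != y).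

Definition min_ordering : Prop :=
  [/\ linear_order_on A leA, linear_order_on B leB
    & forall a a' b b', a \in A -> a' \in A -> b \in B -> b' \in B ->
        adj H a b -> adj H a' b' -> strict leA a a' -> strict leB b' b ->
        adj H a b'].

Definition special_min_ordering : Prop :=
  [/\ min_ordering,
      forall a b b', a \in A -> b \in B -> b' \in B ->
        bicoloured H a b -> unicoloured H a b' -> strict leB b b'
    & forall b a a', b \in B -> a \in A -> a' \in A ->
        bicoloured H b a -> unicoloured H b a' -> strict leA a a'].

Definition same_part_le (x y : W) : Prop :=
  [/\ x \in A, y \in A & leA x y] \/ [/\ x \in B, y \in B & leB x y].

End MinOrdering.

(* Main.v *)
Require Import Defs.
From mathcomp Require Import all_boot.

Set Implicit Arguments.
Unset Strict Implicit.

(** Write [s < t] for the order inside either part.  If a blue edge [st] lies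
    strictly below a bicoloured edge [ab], then [sb] is not an edge: the special
    property at [s] would make it unicoloured, and at [b] bicoloured.  By the min
    ordering property no neighbour of [s] then reaches [b] or goes above it, so
    the whole blue walk [f(C)] stays strictly below [ab]; call such a bicoloured
    edge dominating.  It remains to move along [f'(C)], keeping every edge [uv]
    above some dominating edge [ab].  If the next vertex [w] falls below [a],
    then [wb] is an edge, necessarily bicoloured, and it lies above an edge of
    [f(C)] because [w] lies above a vertex of [f(C)]; hence [wb] is dominating
    and below the edge [vw]. *)

(** * Edges and vertices of walks *)

Section Walks.

Variable V : Type.
Implicit Types (x y : V) (p : seq V).

Lemma walk_edges_cons x y p :
  walk_edges x (y :: p) = (x, y) :: walk_edges y p.
Proof. by []. Qed.

Lemma walk_edges_map (U : Type) (g : V -> U) x p :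
  walk_edges (g x) (map g p) = [seq (g e.1, g e.2) | e <- walk_edges x p].
Proof.
elim: p x => [|y p IHp] x //.
by rewrite /walk_edges /= -/(walk_edges _ _) IHp.
Qed.

Lemma only_edges_path (c : rel V) x p : only_edges c x p = path c x p.
Proof.
elim: p x => [|y p IHp] x //=.
by rewrite /only_edges walk_edges_cons /= -IHp.
Qed.

(* A property of edges that spreads to incident edges and holds somewhere on a
   walk holds on the whole walk. *)
Lemma walk_edges_spread (e : rel V) (Q : V -> V -> Prop) :
    (forall u v, Q u v -> Q v u) ->
    (forall u v w, Q u v -> e v w -> Q v w) ->
    symmetric e ->
  forall (c : rel V) x p,
    (forall u v, c u v -> Q u v) ->
    path e x p -> some_edge c x p ->
  forall (d : rel V), (forall u v, Q u v -> d u v) -> only_edges d x p.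
Proof.
move=> Qsym Qstep esym c x p cQ exp cxp d Qd.
have fwd q : forall u v, Q u v -> path e v q -> only_edges d v q.
  elim: q => [|w q IHq] u v Quv //= /andP[evw ewq].
  have Qvw := Qstep _ _ _ Quv evw.
  by rewrite /only_edges walk_edges_cons /= (Qd _ _ Qvw); apply: IHq Qvw ewq.
(* The second conjunct carries [Q] backwards: from an edge satisfying [c] further along the walk to
   whichever edge leads into [v]. *)
suff main q : forall v, path e v q -> some_edge c v q ->
    only_edges d v q /\ (forall u, e u v -> Q u v).
  by case: (main p x exp cxp).
elim: q => [|w q IHq] v //= /andP[evw ewq].
rewrite /some_edge walk_edges_cons /= => /orP cvwq.
have Qvw : Q v w.
  case: cvwq => [/cQ //|/(IHq w ewq)[_ back]]; exact: back.
split=> [|u euv].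
  by rewrite /only_edges walk_edges_cons /= (Qd _ _ Qvw); apply: fwd Qvw ewq.
by apply/Qsym/(Qstep w); [exact: Qsym | rewrite esym].
Qed.

End Walks.

Lemma walk_edges_mem (T : eqType) (x : T) (p : seq T) (e : T * T) :
  e \in walk_edges x p -> (e.1 \in x :: p) /\ (e.2 \in x :: p).
Proof.
elim: p x => [|y p IHp] x //=; rewrite walk_edges_cons inE => /orP[/eqP->|] /=.
  by rewrite !inE !eqxx orbT.
by case/IHp=> e1 e2; rewrite ![_ \in x :: _]inE e1 e2 !orbT.
Qed.

Lemma walk_vertex_edge (T : eqType) (x : T) (p : seq T) (s : T) :
  p != [::] -> s \in x :: p ->
  exists t, (s, t) \in walk_edges x p \/ (t, s) \in walk_edges x p.
Proof.
elim: p x => [|y p IHp] x //= _; rewrite inE => /orP[/eqP->|].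
  by exists y; left; rewrite walk_edges_cons mem_head.
case: p IHp => [_|z p IHp] sp.
  by move: sp; rewrite inE => /eqP->; exists x; right; rewrite mem_head.
have [//|t tE] := IHp y _ sp.
by exists t; case: tE => tE; [left | right]; rewrite walk_edges_cons in_cons tE orbT.
Qed.

(** [C] lives over a bare type, without membership. Two images of one entry of [C] are therefore
    tracked through membership in the two mapped lists. *)
Lemma has_map_pair (T : Type) (U S : eqType) (P : pred U)
    (g : T -> U) (h : T -> S) (s : seq T) :
  has P (map g s) ->
  exists t, [/\ P (g t), g t \in map g s & h t \in map h s].
Proof.
elim: s => //= t s IHs /orP[Pt|/IHs[t' [Pt' gt' ht']]].
  by exists t; rewrite !mem_head.
by exists t'; rewrite !inE gt' ht' !orbT.
Qed.

(** * The order on the two parts and the special min ordering *)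

Section Domination.

Variables (W : finType) (H : sgraph W) (A B : {set W}) (leA leB : rel W).
Hypothesis Hbip : bipartition H A B.
Hypothesis Hspec : special_min_ordering H A B leA leB.

Local Notation adj := (adj H).
Local Notation bi := (bicoloured H).
Local Notation blue := (blue H).

(** Merging both strict orders into one relation lets the later arguments ignore which part a vertex
    lies in. *)
Definition lt_part (u v : W) : bool :=
  [&& u \in A, v \in A & strict leA u v] || [&& u \in B, v \in B & strict leB u v].

Definition le_part (u v : W) : bool := (u == v) || lt_part u v.

Local Notation "u ~< v" := (lt_part u v) (at level 70).
Local Notation "u ~<= v" := (le_part u v) (at level 70).

Lemma in_partB u : (u \in B) = (u \notin A).
Proof.
case: Hbip => AB AB0 _.
have := in_setT u; have := in_set0 u; rewrite -AB -AB0 !inE.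
by case: (u \in A); case: (u \in B).
Qed.

Lemma adj_part u v : adj u v -> (v \in A) = (u \notin A).
Proof.
case: Hbip => _ _ Badj /Badj; rewrite !in_partB.
by case: (u \in A); case: (v \in A).
Qed.

Lemma adj_sym : symmetric adj.
Proof. by move=> u v; rewrite /Defs.adj plus_sym minus_sym. Qed.

Lemma bi_sym : symmetric bi.
Proof. by move=> u v; rewrite /bicoloured plus_sym minus_sym. Qed.

Lemma blue_sym : symmetric blue.
Proof. by move=> u v; rewrite /Defs.blue plus_sym minus_sym. Qed.

Lemma bi_adj u v : bi u v -> adj u v.
Proof. by rewrite /bicoloured /Defs.adj => /andP[->]. Qed.

Lemma blue_adj u v : blue u v -> adj u v.
Proof. by rewrite /Defs.blue /Defs.adj => /andP[->]. Qed.

Lemma lt_part_same u v : u ~< v -> (u \in A) = (v \in A).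
Proof.
rewrite /lt_part !in_partB.
by case: (u \in A); case: (v \in A); rewrite ?andbF.
Qed.

Lemma le_part_same u v : u ~<= v -> (u \in A) = (v \in A).
Proof. by case/orP=> [/eqP->//|/lt_part_same]. Qed.

Lemma lt_part_irr u : u ~< u = false.
Proof. by rewrite /lt_part /strict eqxx !andbF. Qed.

Lemma strict_trans (D : {set W}) (le : rel W) : linear_order_on D le ->
  {in D & &, transitive (strict le)}.
Proof.
case=> _ anti tr _ v u w vD uD wD /andP[uv nuv] /andP[vw nvw].
rewrite /strict (tr v u w) //=; apply/eqP=> uw; case/eqP: nuv.
by apply: anti => //; rewrite uv uw.
Qed.

Lemma strict_total (D : {set W}) (le : rel W) : linear_order_on D le ->
  {in D &, forall u v, [|| strict le u v, u == v | strict le v u]}.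
Proof.
case=> _ _ _ tot u v uD vD; rewrite /strict [v == u]eq_sym.
by case: eqVneq => [|_] /=; rewrite ?andbT ?orbT ?tot.
Qed.

Lemma lt_part_trans : transitive lt_part.
Proof.
case: Hspec => [[linA linB _] _ _] v u w; rewrite /lt_part.
case/orP=> /and3P[uD vD uv] /orP[] /and3P[vD' wD vw].
- by rewrite uD wD (strict_trans linA vD).
- by move: vD'; rewrite in_partB vD.
- by move: vD; rewrite in_partB vD'.
- by rewrite uD wD (strict_trans linB vD) ?orbT.
Qed.

Lemma lt_le_part_trans u v w : u ~< v -> v ~<= w -> u ~< w.
Proof. by move=> uv /orP[/eqP<-//|]; apply: lt_part_trans. Qed.

Lemma lt_le_partF u v : u ~< v -> v ~<= u -> False.
Proof. by move=> uv /(lt_le_part_trans uv); rewrite lt_part_irr. Qed.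

Lemma le_partVlt u v : (u \in A) = (v \in A) -> u ~<= v \/ v ~< u.
Proof.
case: Hspec => [[linA linB _] _ _] uv; rewrite /le_part /lt_part !in_partB -uv.
case uA: (u \in A) => /=.
  have /or3P[->|->|->] := strict_total linA uA (etrans (esym uv) uA);
    by rewrite ?orbT; auto.
have uB : u \in B by rewrite in_partB uA.
have vB : v \in B by rewrite in_partB -uv uA.
by have /or3P[->|->|->] := strict_total linB uB vB; rewrite ?orbT; auto.
Qed.

Lemma le_part_of u v : same_part_le A B leA leB u v -> u ~<= v.
Proof.
rewrite /le_part /lt_part /strict.
by case: eqVneq => //= _ [] [-> -> ->]; rewrite ?orbT.
Qed.

(** The min ordering condition is symmetric in the two parts: if [a] lies in [B], apply it to the
    reversed edges [b'a'] and [ba], in that order. *)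
Lemma min_part a b a' b' :
  adj a b -> adj a' b' -> a ~< a' -> b' ~< b -> adj a b'.
Proof.
case: Hspec => [[_ _ minAB] _ _] ab ab'.
have sb := adj_part ab; have sb' := adj_part ab'.
case/orP=> /and3P[aD aD' aa'] /orP[] /and3P[bD' bD bb'].
- by move: sb; rewrite aD bD.
- exact: minAB aa' bb'.
- by rewrite adj_sym; apply: (minAB b' b a' a) => //; rewrite adj_sym.
- by move: sb; rewrite !in_partB in aD bD *; rewrite (negbTE bD) aD.
Qed.

Lemma bi_blue_lt a b b' : bi a b -> blue a b' -> b ~< b'.
Proof.
move=> ab ab'; case: Hspec => _ spA spB.
have sb := adj_part (bi_adj ab); have sb' := adj_part (blue_adj ab').
have ub' : unicoloured H a b' by rewrite /unicoloured ab'.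
rewrite /lt_part !in_partB sb sb'; case aA: (a \in A) => /=.
  by apply: spA ab ub'; rewrite // in_partB ?sb ?sb' aA.
by rewrite orbF; apply: spB ab ub'; rewrite ?in_partB ?sb ?sb' aA.
Qed.

Lemma adj_bi_or_blue a b : no_purely_red H -> adj a b -> bi a b \/ blue a b.
Proof.
move=> /(_ a b); rewrite /red /Defs.adj /bicoloured /Defs.blue.
by case: (plus H a b); case: (minus H a b) => //=; auto.
Qed.

(** * Blue edges below a bicoloured edge *)

Hypothesis Hnored : no_purely_red H.

(** Otherwise [ab] is blue, and the special property at [a] puts [b'] before [b]. *)
Lemma adj_lt_bi a b b' : adj a b -> bi a b' -> b ~< b' -> bi a b.
Proof.
move=> /(adj_bi_or_blue Hnored)[//|/bi_blue_lt ab] /ab b'b bb'.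
by have := lt_part_trans bb' b'b; rewrite lt_part_irr.
Qed.

(** If [s] were [a], the special property there would put [b] strictly below [t]. *)
Lemma bi_above_blue_lt s t a b :
  blue s t -> bi a b -> s ~<= a -> t ~<= b -> s ~< a.
Proof.
move=> st ab /orP[/eqP sa|//] tb; rewrite sa in st.
by case: (lt_le_partF (bi_blue_lt ab st) tb).
Qed.

Lemma bi_above_blue_nadj s t a b :
  blue s t -> bi a b -> s ~< a -> t ~< b -> ~~ adj s b.
Proof.
move=> st ab sa tb; apply/negP=> sb.
have bsb : bi b s by apply: (@adj_lt_bi _ _ a); rewrite // 1?adj_sym 1?bi_sym.
rewrite bi_sym in bsb.
by have := lt_part_trans tb (bi_blue_lt bsb st); rewrite lt_part_irr.
Qed.

Lemma bi_above_blue_step s t w a b :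
  blue s t -> bi a b -> s ~< a -> t ~< b -> blue s w -> w ~< b.
Proof.
move=> st ab sa tb sw; have nsb := bi_above_blue_nadj st ab sa tb.
have wb : (b \in A) = (w \in A).
  by rewrite -(lt_part_same tb) (adj_part (blue_adj st)) (adj_part (blue_adj sw)).
case: (le_partVlt wb) => [/orP[/eqP bw|bw]|//]; case/negP: nsb.
  by rewrite bw blue_adj.
exact: min_part (blue_adj sw) (bi_adj ab) sa bw.
Qed.

(** * Edges dominating a blue walk *)

Variables (x0 : W) (q : seq W).
Hypothesis blue_walk : path blue x0 q.

(** A vertex [s] is comparable only with the end of [ab] in its own part, hence the disjunction. *)
Definition dominating (a b : W) : bool :=
  bi a b && all (fun s => (s ~< a) || (s ~< b)) (x0 :: q).

Lemma dominating_sym a b : dominating a b -> dominating b a.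
Proof.
case/andP=> ab /allP Sab; rewrite /dominating bi_sym ab.
by apply/allP=> s /Sab; rewrite orbC.
Qed.

Lemma dominating_above a b s t : bi a b ->
  (s, t) \in walk_edges x0 q -> s ~<= a -> t ~<= b -> dominating a b.
Proof.
move=> ab stE sa tb; rewrite /dominating ab.
(* Consecutive edges of the walk face [ab] in opposite orientations, so [Q] allows both; the
   spreading starts from the single edge [st]. *)
pose Q u v := blue u v /\ (u ~< a /\ v ~< b \/ u ~< b /\ v ~< a).
pose d u v := ((u ~< a) || (u ~< b)) && ((v ~< a) || (v ~< b)).
have ba : bi b a by rewrite bi_sym.
have dq : only_edges d x0 q.
  apply: (@walk_edges_spread _ blue Q _ _ blue_sym (fun u v => (u, v) == (s, t)))
    => // [u v [uv ab_uv]|u v w [uv ab_uv] vw|u v /eqP[-> ->]||u v [_ ab_uv]].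
  - by split; [rewrite blue_sym | case: ab_uv => -[]; auto].
  - have vu : blue v u by rewrite blue_sym.
    split=> //; case: ab_uv => [[ua vb]|[ub va]]; [right | left]; split=> //.
      exact: bi_above_blue_step vu ba vb ua vw.
    exact: bi_above_blue_step vu ab va ub vw.
  - have st : blue s t.
      by move: blue_walk; rewrite -only_edges_path => /allP/(_ _ stE).
    have ts : blue t s by rewrite blue_sym.
    split=> //; left; split; first exact: bi_above_blue_lt st ab sa tb.
    exact: bi_above_blue_lt ts ba tb sa.
  - by apply/hasP; exists (s, t) => /=.
  - by rewrite /d; case: ab_uv => -[-> ->]; rewrite ?orbT.
have qn0 : q != [::] by case: q stE.
apply/allP=> r /(walk_vertex_edge qn0)[r' [] rE].
  by have /andP[] := allP dq _ rE.
by have /andP[] := allP dq _ rE.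
Qed.

Lemma dominating_lt a b s : dominating a b -> s \in x0 :: q ->
  (s \in A) = (a \in A) -> s ~< a.
Proof.
case/andP=> /bi_adj/adj_part ab /allP Sab /Sab/orP[//|/lt_part_same sb] sa.
by move: ab; rewrite -sb -sa; case: (s \in A).
Qed.

Definition above_dominating (u v : W) : Prop :=
  exists a b, [/\ dominating a b, a ~<= u & b ~<= v].

Lemma above_dominating_sym u v : above_dominating u v -> above_dominating v u.
Proof. by case=> a [b [/dominating_sym ab au bv]]; exists b, a. Qed.

(** A walk vertex in the part of [a] is strictly below [a], while [u] is not. *)
Lemma above_dominating_notin u v : above_dominating u v -> u \notin x0 :: q.
Proof.
case=> a [b [ab au _]]; apply/negP=> uS.
exact: lt_le_partF (dominating_lt ab uS (esym (le_part_same au))) au.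
Qed.

Lemma above_dominating_step u v w : q != [::] ->
  above_dominating u v -> adj u v -> adj v w ->
  has (fun s => s ~<= w) (x0 :: q) -> above_dominating v w.
Proof.
move=> qn0 [a [b [ab au bv]]] uv vw /hasP[s sS sw].
have bab : bi a b by case/andP: ab.
have aw : (a \in A) = (w \in A).
  by rewrite (le_part_same au) (adj_part vw) (adj_part uv) negbK.
case: (le_partVlt aw) => [aw'|wa].
  by exists b, a; split=> //; apply: dominating_sym.
(* Either [b] is [v], or the min ordering property on [ba] and [vw] yields the edge [bw]. As [w]
   precedes the bicoloured neighbour [a] of [b], this edge is bicoloured. *)
have bw : bi b w.
  have bba : bi b a by rewrite bi_sym.
  case/orP: bv => [/eqP bv|bv].
    by rewrite -bv in vw; apply: adj_lt_bi vw bba wa.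
  exact: adj_lt_bi (min_part (bi_adj bba) vw bv wa) bba wa.
(* Since [ab] dominates, any walk edge at [s] has its other end below [b], so that edge lies below
   [wb], as [dominating_above] requires. *)
have sb t : adj s t -> t \in x0 :: q -> t ~<= b.
  move=> st tS; apply/orP; right.
  apply: (dominating_lt (dominating_sym ab) tS).
  rewrite (adj_part st) (adj_part (bi_adj bab)).
  by rewrite (le_part_same sw) aw.
have ww : w ~<= w by rewrite /le_part eqxx.
have wb : bi w b by rewrite bi_sym.
have blueE := allP (etrans (only_edges_path blue x0 q) blue_walk).
have [t [] tE] := walk_vertex_edge qn0 sS; exists b, w; split=> //.
  have [_ tS] := walk_edges_mem tE.
  apply/dominating_sym/(dominating_above wb tE sw)/sb => //.
  exact: blue_adj (blueE _ tE).
have [tS _] := walk_edges_mem tE.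
apply: (dominating_above bw tE) sw; apply: sb => //.
by rewrite adj_sym; apply: blue_adj (blueE _ tE).
Qed.

End Domination.
Theorem theorem4 (W : finType) (H : sgraph W) (A B : {set W}) (leA leB : rel W)
    (Hwb : weakly_balanced H)
    (Hnored : no_purely_red H)
    (Hbip : bipartition H A B)
    (Hspec : special_min_ordering H A B leA leB)
    (V : Type) (G : sgraph V)
    (x : V) (p : seq V) (HC : closed_walk G x p)
    (f f' : V -> W) (Hf : is_shom G H f) (Hf' : is_shom G H f')
    (Hle : forall v : V, same_part_le A B leA leB (f v) (f' v))
    (Hblue : only_edges (blue H) (f x) (map f p))
    (Hbi : some_edge (bicoloured H) (f' x) (map f' p)) :
  forall w : W, ~ (w \in map f (x :: p) /\ w \in map f' (x :: p)).
Proof.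
case: HC => Cpath _; case: Hf' => adj' _ _.
have bluep : path (blue H) (f x) (map f p) by rewrite -only_edges_path.
have le_ff' v : le_part A B leA leB (f v) (f' v) by apply: le_part_of.
have pn0 : map f p != [::] by case: (p) Hbi.
pose S := f x :: map f p; pose S' := f' x :: map f' p.
pose above t := has (fun s => le_part A B leA leB s t) S.
(* The step lemma needs the new vertex to lie above a vertex of [f(C)]. Building this into [e] at
   both ends keeps [e] symmetric. *)
pose e u v := [&& adj H u v, above u & above v].
pose Q u v := adj H u v /\ above_dominating H A B leA leB (f x) (map f p) u v.
pose outside u v := (u \notin S) && (v \notin S).
have aboveS' t : t \in S' -> above t.
  rewrite /S' -map_cons -has_pred1 => /(has_map_pair f)[v [/eqP <- _ vS]].
  by apply/hasP; exists (f v).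
have S'path : path e (f' x) (map f' p).
  apply: (@sub_in_path _ above (adj H)) => [u v uS vS uv||].
  - exact/and3P.
  - exact/allP.
  - by rewrite path_map; apply: sub_path Cpath => u v /adj'.
have esym : symmetric e.
  by move=> u v; rewrite /e adj_sym [above u && _]andbC.
(* A bicoloured edge of [f'(C)] lies above the image under [f] of the same edge of [C], hence
   dominates [f(C)]. *)
have S'edge : some_edge (dominating H A B leA leB (f x) (map f p))
    (f' x) (map f' p).
  have := Hbi; rewrite {1}/some_edge walk_edges_map.
  case/(has_map_pair (fun c => (f c.1, f c.2))) => -[u v] /= [bi_uv uvE' uvE].
  rewrite -!walk_edges_map in uvE uvE'.
  apply/hasP; exists (f' u, f' v) => //=.
  exact: (dominating_above Hbip Hspec Hnored bluep bi_uv uvE).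
have S'out : only_edges outside (f' x) (map f' p).
  apply: (@walk_edges_spread _ e Q _ _ esym _ _ _ _ S'path S'edge)
    => [u v [uv duv]|u v w [uv duv] /and3P[vw _ wS]|u v duv|u v [uv duv]].
  - by split; [rewrite adj_sym | apply: above_dominating_sym].
  - by split=> //; apply: above_dominating_step duv uv vw wS.
  - split; first by case/andP: duv => /bi_adj.
    by exists u, v; rewrite /le_part !eqxx.
  - apply/andP; split; first exact: above_dominating_notin duv.
    exact: above_dominating_notin (above_dominating_sym duv).
(* With at least one edge in the walk, every vertex of [f'(C)] is an end of some edge, to which
   [S'out] applies. *)
have p'n0 : map f' p != [::] by case: (p) pn0.
move=> w [wS /(walk_vertex_edge p'n0)[t [] /(allP S'out)/andP[]]] /=.
  by rewrite /S wS.
by rewrite /S wS.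
Qed.
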